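(* Let $R=\{(1,0),(1,1),(2,0),(2,1),(2,2),(2,3),(3,0),(3,1),(3,3)\}$ and let $\mathrm{P}_5=(123,R)$ and $\mathrm{P}_6=(132,R)$ be mesh patterns. For every $n\ge 1$ and all integers $k,\ell\ge 0$, $$|\{\sigma\in\mathfrak{S}_n: \mathrm{P}_5(\sigma)=k,\ \mathrm{P}_6(\sigma)=\ell\}| = |\{\sigma\in\mathfrak{S}_n: \mathrm{P}_6(\sigma)=k,\ \mathrm{P}_5(\sigma)=\ell\}|.$$
   Context: $\mathfrak{S}_n$ is the set of permutations $\sigma=\sigma_1\sigma_2\cdots\sigma_n$ of $[n]=\{1,\dots,n\}$ in one-line notation. A mesh pattern is a pair $p=(\pi,R)$ with $\pi\in\mathfrak{S}_m$ and $R\subseteq\{0,\dots,m\}\times\{0,\dots,m\}$ (the set of shaded unit cells, each given by its bottom-left corner, in the grid with dots at $(i,\pi_i)$). An occurrence of $p$ in $\sigma\in\mathfrak{S}_n$ is a choice of indices $i_1<\cdots<i_m$ such that $\sigma_{i_1}\cdots\sigma_{i_m}$ is order-isomorphic to $\pi$ and, for every $(a,b)\in R$, there is no index $r$ with $i_a<r<i_{a+1}$ and $v_b<\sigma_r<v_{b+1}$; here $v_1<\cdots<v_m$ is the increasing rearrangement of $\sigma_{i_1},\dots,\sigma_{i_m}$, $i_0=v_0=0$ and $i_{m+1}=v_{m+1}=n+1$. $p(\sigma)$ denotes the number of occurrences of $p$ in $\sigma$. *)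

(* Defs.v *)
From mathcomp Require Import all_boot all_fingroup.

Set Implicit Arguments.
Unset Strict Implicit.
Unset Printing Implicit Defensive.

(* A permutation of {1,...,n} in one-line notation sigma_1 ... sigma_n is an   *)
(* element s of 'S_n = {perm 'I_n}, shifted by one: sigma_(i+1) = (s i).+1 for *)
(* i : 'I_n.  Shaded cells keep their coordinates in {0,...,m} x {0,...,m}.    *)

Record mesh_pattern (m : nat) := MeshPattern {
  mesh_perm : 'S_m;
  mesh_shading : {set 'I_m.+1 * 'I_m.+1}
}.

Section MeshOccurrences.

Variables (m n : nat) (p : mesh_pattern m) (s : 'S_n) (t : m.-tuple 'I_n).

Definition increasing_indices : bool := sorted ltn [seq val i | i <- t].

Definition order_isomorphic : bool :=
  [forall j : 'I_m, forall k : 'I_m,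
     (s (tnth t j) < s (tnth t k)) == (mesh_perm p j < mesh_perm p k)].

(* The sequences i_0 < i_1 < ... < i_(m+1) and v_0 < v_1 < ... < v_(m+1), with *)
(* 1-based entries, so that the end points are 0 and n + 1.                    *)
Definition grid_columns : seq nat :=
  0 :: rcons [seq (val i).+1 | i <- t] n.+1.

Definition grid_rows : seq nat :=
  0 :: rcons (sort leq [seq (val (s i)).+1 | i <- t]) n.+1.

Definition in_cell (a b : nat) (r : 'I_n) : bool :=
  (nth 0 grid_columns a < r.+1 < nth 0 grid_columns a.+1) &&
  (nth 0 grid_rows b < (s r).+1 < nth 0 grid_rows b.+1).

Definition mesh_occurrence : bool :=
  [&& increasing_indices, order_isomorphic &
      [forall c in mesh_shading p, forall r : 'I_n, ~~ in_cell c.1 c.2 r]].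

End MeshOccurrences.

Definition mesh_count (m n : nat) (p : mesh_pattern m) (s : 'S_n) : nat :=
  #|[set t : m.-tuple 'I_n | mesh_occurrence p s t]|.

Definition R56 : {set 'I_4 * 'I_4} :=
  [set c : 'I_4 * 'I_4 | (val c.1, val c.2) \in
    [:: (1, 0); (1, 1); (2, 0); (2, 1); (2, 2); (2, 3);
        (3, 0); (3, 1); (3, 3)]].

Definition perm123 : 'S_3 := 1%g.
Definition perm132 : 'S_3 := tperm (inord 1) (inord 2).

Lemma perm123_one_line : [seq (val (perm123 i)).+1 | i : 'I_3] = [:: 1; 2; 3].
Proof.
have -> : [seq (val (perm123 i)).+1 | i : 'I_3] = map succn (map val (enum 'I_3)).
  by rewrite -map_comp; apply: eq_map => i /=; rewrite perm1.
by rewrite val_enum_ord.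
Qed.

Lemma perm132_one_line : [seq (val (perm132 i)).+1 | i : 'I_3] = [:: 1; 3; 2].
Proof.
have -> : [seq (val (perm132 i)).+1 | i : 'I_3] =
    map (fun k => (if k == 1 then 2 else if k == 2 then 1 else k).+1)
        (map val (enum 'I_3)).
  rewrite -map_comp; apply: eq_map => i /=; congr S.
  by rewrite permE /= -!val_eqE /= !inordK //; do 2 (case: ifP => _; rewrite ?inordK //).
by rewrite val_enum_ord.
Qed.

Definition P5 : mesh_pattern 3 := MeshPattern perm123 R56.
Definition P6 : mesh_pattern 3 := MeshPattern perm132 R56.

(* Main.v *)
Require Import Defs.
From mathcomp Require Import all_boot all_fingroup zify.

(** In an occurrence of either pattern at positions [a < b < c], the shaded
    column 2 forces [c = b + 1].  Let [lo < hi] be the two values at [b] and [c].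
    The shaded cells of column 3 say that all values after [c] lie strictly
    between [lo] and [hi], and those of column 1 say that [a] is the last
    position before [b] with a value below [lo].  So [a] is determined by [b],
    and it exists exactly when the least value of [s] sits before [b]
    ([mesh_count_frames]).  Hence both statistics count the positions [b] to the
    right of the least value at which the first two entries of the suffix
    starting at [b] are its extreme values, and P5 or P6 is counted according
    to the order of these two entries.

    Reversing the order of the values that occur to the right of the least value
    ([flip_tail]) fixes the position of that value, keeps the set of values to
    the right of it, and turns minima of such suffixes into maxima.  It is
    therefore an involution of the symmetric group that exchanges the two
    statistics. *)

Set Implicit Arguments.
Unset Strict Implicit.
Unset Printing Implicit Defensive.

(** * Reversing the order of a set of values *)

Section Flip.

Variables (n : nat) (B : {set 'I_n}).

Definition flip (x : 'I_n) : 'I_n :=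
  if x \in B then nth x (rev (enum B)) (index x (enum B)) else x.

Lemma flip_out x : x \notin B -> flip x = x.
Proof. by rewrite /flip => /negbTE->. Qed.

Lemma flip_mem x : (flip x \in B) = (x \in B).
Proof.
rewrite /flip; case: ifP => xB //.
by rewrite -mem_enum -mem_rev mem_nth // size_rev index_mem mem_enum.
Qed.

Lemma index_flip x : x \in B ->
  index (flip x) (enum B) = size (enum B) - (index x (enum B)).+1.
Proof.
move=> xB; have ltx : index x (enum B) < size (enum B).
  by rewrite index_mem mem_enum.
rewrite /flip xB nth_rev // index_uniq ?enum_uniq //.
by move: (size _) (index _ _) ltx => N i; lia.
Qed.

Lemma flipK : involutive flip.
Proof.
move=> x; have [xB|xB] := boolP (x \in B); last by rewrite !flip_out.
have ltx : index x (enum B) < size (enum B) by rewrite index_mem mem_enum.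
have fB : flip x \in B by rewrite flip_mem.
apply: (index_inj x (s := enum B)); rewrite ?mem_enum ?flip_mem //=.
rewrite !index_flip //.
by move: (size _) (index _ _) ltx => N i; lia.
Qed.

(** [enum B] is increasing, so comparing indices in it compares values. *)
Lemma ltn_index_enum x y : x \in B -> y \in B ->
  index x (enum B) < index y (enum B) -> x < y.
Proof.
move=> xB yB; apply: (@sorted_ltn_index _ (relpre val ltn)); rewrite ?mem_enum //.
  by move=> ? ? ? /=; apply: ltn_trans.
apply: sorted_filter; first by move=> ? ? ? /=; apply: ltn_trans.
by rewrite -enumT -sorted_map val_enum_ord iota_ltn_sorted.
Qed.

Lemma ltn_flip x y : x \in B -> y \in B -> (flip x < flip y) = (y < x).
Proof.
have anti u v : u \in B -> v \in B -> v < u -> flip u < flip v.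
  move=> uB vB lt_vu; apply: ltn_index_enum; rewrite ?flip_mem //.
  have ltu : index u (enum B) < size (enum B) by rewrite index_mem mem_enum.
  rewrite !index_flip //.
  suff: index v (enum B) < index u (enum B).
    by move: (size _) (index u _) (index v _) ltu => N i j; lia.
  rewrite ltn_neqAle leqNgt; apply/andP; split; last first.
    by apply/negP => /(ltn_index_enum uB vB); lia.
  apply/eqP => /(index_inj u) e; move: lt_vu.
  by rewrite e ?mem_enum // ltnn.
move=> xB yB; apply/idP/idP; last exact: anti.
by move=> /anti; rewrite !flip_mem !flipK; apply.
Qed.

Definition flip_perm : 'S_n := perm (inv_inj flipK).

End Flip.

(** * The two statistics in terms of suffixes *)

(** Both patterns are treated at once: [d] tells whether the last two letters
    form a descent, and [low d b c], [low (~~ d) b c] are then the positions of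
    the smaller and of the larger one. *)
Definition pattern56 (d : bool) : mesh_pattern 3 := if d then P6 else P5.

Definition low (T : Type) (d : bool) (b c : T) : T := if d then c else b.

(** When [c] is the position right after [b] and [i], [j] are [b], [c] in some
    order, this says that the suffix starting at [b] has its least and greatest
    values at [i] and [j]. *)
Definition frames (n : nat) (s : 'S_n) (c i j : 'I_n) : bool :=
  (s i < s j) && [forall r : 'I_n, (c < r) ==> (s i < s r < s j)].

Section Occurrences.

Variables (n : nat) (s : 'S_n).

Lemma perm_neq_nat (i j : 'I_n) : i != j :> nat -> s i != s j :> nat.
Proof. by apply: contraNneq => /val_inj/perm_inj->. Qed.

Lemma order_isomorphic_pattern56 d (a b c : 'I_n) :
  order_isomorphic (pattern56 d) s [tuple a; b; c] =
  (s a < s (low d b c)) && (s (low d b c) < s (low (~~ d) b c)).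
Proof.
have i1 : nat_of_ord (inord 1 : 'I_3) = 1 by rewrite inordK.
have i2 : nat_of_ord (inord 2 : 'I_3) = 2 by rewrite inordK.
have I3 (Q : 'I_3 -> bool) :
    [forall j, Q j] = [&& Q ord0, Q (inord 1) & Q (inord 2)].
  apply/forallP/and3P => [//|[Q0 Q1 Q2] [[|[|[|//]]] lt_j3]].
  - by rewrite (_ : Ordinal _ = ord0) //; apply: val_inj.
  - by rewrite (_ : Ordinal _ = inord 1) //; apply: val_inj; rewrite /= i1.
  - by rewrite (_ : Ordinal _ = inord 2) //; apply: val_inj; rewrite /= i2.
rewrite /order_isomorphic I3 !I3 !(tnth_nth a) i1 i2 /=.
by case: d; rewrite /= /perm123 /perm132 ?perm1 ?tpermL ?tpermR ?tpermD -?val_eqE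
  /= ?i1 ?i2 //=; lia.
Qed.

(** Shaded column 2 leaves no room between [b] and [c].  In columns 1 and 3 the
    values at the three chosen positions are not taken again, so excluding the
    shaded cells leaves only the values above the middle row line in column 1
    and those between the two upper row lines in column 3. *)
Lemma mesh_occurrenceP d (a b c : 'I_n) :
  reflect [/\ a < b, c = b.+1 :> nat, s a < s (low d b c),
              forall r : 'I_n, a < r < b -> s (low d b c) < s r
            & frames s c (low d b c) (low (~~ d) b c)]
    (mesh_occurrence (pattern56 d) s [tuple a; b; c]).
Proof.
rewrite /mesh_occurrence order_isomorphic_pattern56.
have -> : increasing_indices [tuple a; b; c] = (a < b < c).
  by rewrite /increasing_indices /= andbT.
have shade : mesh_shading (pattern56 d) = R56 by case: d.
rewrite shade /frames.
set lo := low d b c; set hi := low (~~ d) b c.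
have [/andP[lt_ab lt_bc]|nlt] := boolP (a < b < c); last first.
  by right=> -[]; lia.
have [/andP[lt_alo lt_lohi]|nlt] :=
  boolP ((s a < s lo) && (s lo < s hi)); last first.
  by right=> -[_ _ lt_alo _ /andP[lt_lohi _]]; rewrite lt_alo lt_lohi in nlt.
rewrite lt_lohi /=.
have rows : grid_rows s [tuple a; b; c] =
    [:: 0; (s a).+1; (s lo).+1; (s hi).+1; n.+1].
  rewrite /grid_rows -[RHS]/(0 :: rcons [:: _; _; _] n.+1).
  congr (_ :: rcons _ n.+1).
  apply: (sorted_eq leq_trans anti_leq); first exact: sort_sorted leq_total _.
    by rewrite /= andbT; lia.
  rewrite perm_sort /lo /hi /low; case: (d) => //=.
  by rewrite perm_cons; apply/seq.permP => p /=; rewrite !addn0 addnC.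
have cell i j r : in_cell s [tuple a; b; c] i j r =
    (nth 0 [:: 0; a.+1; b.+1; c.+1; n.+1] i < r.+1
       < nth 0 [:: 0; a.+1; b.+1; c.+1; n.+1] i.+1) &&
    (nth 0 [:: 0; (s a).+1; (s lo).+1; (s hi).+1; n.+1] j < (s r).+1
       < nth 0 [:: 0; (s a).+1; (s lo).+1; (s hi).+1; n.+1] j.+1).
  by rewrite /in_cell rows.
have neq := perm_neq_nat.
have lobc : (lo = b :> nat /\ hi = c :> nat) \/ (lo = c :> nat /\ hi = b :> nat).
  by rewrite /lo /hi /low; case: (d); [right|left].
apply: (iffP forall_inP) => [free|[_ c_b1 _ above /forallP after] [i j]].
  have {}free i j r : (i, j) \in [:: (1, 0); (1, 1); (2, 0); (2, 1); (2, 2);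
      (2, 3); (3, 0); (3, 1); (3, 3)] -> ~~ in_cell s [tuple a; b; c] i j r.
    move=> Rij; have [lt_i lt_j] : i < 4 /\ j < 4.
      by move: Rij; rewrite !inE !xpair_eqE; lia.
    have /free/forallP/(_ r) : (Ordinal lt_i, Ordinal lt_j) \in R56 by rewrite inE.
    by [].
  have bounds r : s r < n by [].
  split=> //.
  - apply/eqP; rewrite eqn_leq lt_bc andbT leqNgt; apply/negP => lt_b1c.
    have lt_b1n : b.+1 < n by apply: ltn_trans lt_b1c _.
    pose r := Ordinal lt_b1n.
    (* The value at [b + 1] lies in one of the four cells of column 2. *)
    have := free 2 0 r isT; have := free 2 1 r isT.
    have := free 2 2 r isT; have := free 2 3 r isT.
    rewrite !cell /=; have := bounds r.
    have := @neq r a; have := @neq r lo; have := @neq r hi; rewrite /=; lia.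
  - move=> r /andP[lt_ar lt_rb].
    have := free 1 0 r isT; have := free 1 1 r isT; rewrite !cell /=.
    have := @neq r a; have := @neq r lo; lia.
  - apply/forallP => r; apply/implyP => lt_cr.
    have := free 3 0 r isT; have := free 3 1 r isT; have := free 3 3 r isT.
    rewrite !cell /=; have := bounds r.
    have := @neq r a; have := @neq r lo; have := @neq r hi; have := ltn_ord r; lia.
rewrite inE => Rij; apply/forallP => r; rewrite cell.
have := above r; have := after r.
by move: Rij; rewrite !inE !xpair_eqE /=;
  case/or4P=> [||| /or4P[||| /or3P[||]]] => /andP[/eqP-> /eqP->] /=; lia.
Qed.

(** Sending an occurrence to its last two positions [b, c] is injective, because
    its first position must be the last one before [b] with a value below both
    others.  Such a position exists as soon as the position [p] of the least
    value precedes [b]; if [p] does not, the suffix from [b] contains the least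
    value, so that no smaller value is left for the first entry. *)
Lemma mesh_count_frames d (p : 'I_n) : s p = 0 :> nat ->
  mesh_count (pattern56 d) s =
  #|[set bc : 'I_n * 'I_n | [&& p < bc.1, bc.2 == bc.1.+1 :> nat &
       frames s bc.2 (low d bc.1 bc.2) (low (~~ d) bc.1 bc.2)]]|.
Proof.
move=> sp0; rewrite /mesh_count.
pose f (t : 3.-tuple 'I_n) := (tnth t (inord 1), tnth t (inord 2)).
have fE a b c : f [tuple a; b; c] = (b, c).
  by rewrite /f !(tnth_nth a) !inordK.
have tupleE (t : 3.-tuple 'I_n) : exists a b c, t = [tuple a; b; c].
  case: t => [[|a [|b [|c [|//]]]]] // sz_t; exists a, b, c; exact: val_inj.
have neq := perm_neq_nat.
rewrite -(@card_in_imset _ _ f) => [|t u]; last first.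
  have [a [b [c ->]]] := tupleE t; have [a' [b' [c' ->]]] := tupleE u.
  rewrite !inE !fE => /mesh_occurrenceP[lt_ab _ lt_a gt_a _].
  move=> /mesh_occurrenceP[lt_ab' _ lt_a' gt_a' _] [eb ec].
  move: lt_ab' lt_a' gt_a'; rewrite -eb -ec => lt_ab' lt_a' gt_a'.
  suff -> : a = a' by [].
  apply: val_inj; case: (ltngtP a a') => // [lt_aa|gt_aa].
    by have := gt_a a'; lia.
  by have := gt_a' a; lia.
apply: eq_card => -[b c]; rewrite [RHS]inE /=.
apply/imsetP/and3P => [[t]|[lt_pb /eqP c_b1 fr]].
  have [a [b' [c' ->]]] := tupleE t; rewrite inE fE.
  move=> /mesh_occurrenceP[lt_ab c_b1 lt_a _ fr] [-> ->]; split=> //;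
    last exact/eqP.
  (* Since [s a] is smaller than both values, [p] is neither [b'] nor [c'], so
     it would lie after [c'], where all values exceed [s (low d b' c')]. *)
  rewrite ltnNge; apply/negP => le_bp.
  move: fr => /andP[lt_lohi /forallP/(_ p)]; rewrite sp0.
  suff -> : c' < p by lia.
  have ne_bp : p != b'.
    by apply/eqP => ebp; move: lt_a lt_lohi; rewrite -ebp /low; case: (d) => /=; lia.
  have ne_cp : p != c'.
    by apply/eqP => ecp; move: lt_a lt_lohi; rewrite -ecp /low; case: (d) => /=; lia.
  by move: ne_bp ne_cp; rewrite -!val_eqE /=; lia.
pose lo := low d b c.
have sp_lo : (p < b) && (s p < s lo).
  rewrite lt_pb sp0 lt0n -sp0 eq_sym neq // /lo /low; case: (d); lia.
case: (@arg_maxnP _ p (fun i : 'I_n => (i < b) && (s i < s lo)) val sp_lo).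
move=> a /andP[lt_ab lt_a] max_a.
exists [tuple a; b; c]; last by rewrite fE.
rewrite inE; apply/mesh_occurrenceP; split=> // r /andP[lt_ar lt_rb].
rewrite -/lo ltnNge; apply/negP => le_rlo.
have ne_rlo : s r != s lo :> nat by apply: neq; rewrite /lo /low; case: (d); lia.
have := max_a r; rewrite lt_rb ltn_neqAle ne_rlo le_rlo => /(_ isT) /=; lia.
Qed.

End Occurrences.

(** * Flipping the values to the right of the least one *)

Section FlipTail.

Variable n : nat.
Implicit Types s : 'S_n.+1.

Definition least_pos s : 'I_n.+1 := (s^-1)%g ord0.

Definition tail_values s : {set 'I_n.+1} := [set v | least_pos s < (s^-1)%g v].

Definition flip_tail s : 'S_n.+1 := (s * flip_perm (tail_values s))%g.

Lemma least_posE s : s (least_pos s) = ord0.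
Proof. exact: permKV. Qed.

Lemma tail_valuesE s i : (s i \in tail_values s) = (least_pos s < i).
Proof. by rewrite inE permK. Qed.

Lemma flip_tailE s i : flip_tail s i = flip (tail_values s) (s i).
Proof. by rewrite permM permE. Qed.

Lemma least_pos_flip_tail s : least_pos (flip_tail s) = least_pos s.
Proof.
apply: (@perm_inj _ (flip_tail s)).
rewrite least_posE flip_tailE flip_out ?least_posE //.
by rewrite -(least_posE s) tail_valuesE ltnn.
Qed.

Lemma tail_values_flip_tail s : tail_values (flip_tail s) = tail_values s.
Proof.
apply/setP => v; rewrite -[v](permKV (flip_tail s)) tail_valuesE.
by rewrite flip_tailE flip_mem tail_valuesE least_pos_flip_tail.
Qed.

Lemma flip_tailK : involutive flip_tail.
Proof.
by move=> s; apply/permP => i; rewrite !flip_tailE tail_values_flip_tail flipK.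
Qed.

Lemma ltn_flip_tail s (i j : 'I_n.+1) : least_pos s < i -> least_pos s < j ->
  (flip_tail s i < flip_tail s j) = (s j < s i).
Proof. by move=> pi pj; rewrite !flip_tailE ltn_flip ?tail_valuesE. Qed.

Lemma frames_flip_tail s (c i j : 'I_n.+1) :
  least_pos s < c -> least_pos s < i -> least_pos s < j ->
  frames (flip_tail s) c i j = frames s c j i.
Proof.
move=> pc pi pj; rewrite /frames ltn_flip_tail //; congr (_ && _).
apply: eq_forallb => r; have [lt_cr|//] := boolP (c < r).
have pr := ltn_trans pc lt_cr.
by rewrite !ltn_flip_tail // andbC.
Qed.

(** All positions compared in [mesh_count_frames] lie to the right of the least
    value, where [flip_tail] reverses every comparison of values. *)
Lemma mesh_count_flip_tail d s :
  mesh_count (pattern56 d) (flip_tail s) = mesh_count (pattern56 (~~ d)) s.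
Proof.
have sp0 (u : 'S_n.+1) : u (least_pos u) = 0 :> nat by rewrite least_posE.
rewrite (mesh_count_frames _ (sp0 _)) (mesh_count_frames _ (sp0 _)).
apply: eq_card => -[b c]; rewrite !inE /= least_pos_flip_tail negbK.
have [lt_pb|//] := boolP (least_pos s < b).
have [/eqP c_b1|//] := boolP (c == b.+1 :> nat).
have lt_pc : least_pos s < c by rewrite c_b1 ltnS ltnW.
by rewrite frames_flip_tail // /low; case: (d).
Qed.

End FlipTail.

Theorem mainTheorem3 (n : nat) (hn : 0 < n) (k l : nat) :
  #|[set s : 'S_n | (mesh_count P5 s == k) && (mesh_count P6 s == l)]| =
  #|[set s : 'S_n | (mesh_count P6 s == k) && (mesh_count P5 s == l)]|.
Proof.
case: n hn => // n _.
rewrite -(card_preimset _ (inv_inj (@flip_tailK n))).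
apply: eq_card => s; rewrite !inE.
by rewrite (mesh_count_flip_tail false) (mesh_count_flip_tail true).
Qed.
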